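(* Let $q$ be a power of an odd prime with $q\equiv 3 \pmod 4$, and let $d\equiv 3 \pmod 4$ be a positive integer. Let $P\subset \mathbb{F}_q^d$ be a set of points and let $S$ be a set of spheres in $\mathbb{F}_q^d$ all of whose radii are squares in $\mathbb{F}_q$. If $|P|\le N$ and $|S|\le N$, then \[ I(P,S)\ll q^{-1}N^2+q^{\frac{d-1}{2}}N. \]
   Context: A sphere in $\mathbb{F}_q^d$ with center $c=(c_1,\dots,c_d)\in\mathbb{F}_q^d$ and radius $r\in\mathbb{F}_q$ is the set $\{x\in\mathbb{F}_q^d : (x_1-c_1)^2+\cdots+(x_d-c_d)^2=r\}$; spheres are indexed by the pair (center, radius). A radius $r$ is a square if $r=t^2$ for some $t\in\mathbb{F}_q$. The number of incidences is $I(P,S)=\#\{(p,s)\in P\times S : p\in s\}$. $X\ll Y$ means $X\le C Y$ for an absolute constant $C>0$. *)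

(* Defs.v *)
From HB Require Import structures.
From mathcomp Require Import all_boot all_order all_algebra all_field.
Set Implicit Arguments. Unset Strict Implicit. Unset Printing Implicit Defensive.
Import Order.TTheory GRing.Theory Num.Theory.
Local Open Scope ring_scope.

Definition on_sphere (F : fieldType) (d : nat) (x : 'rV[F]_d) (s : 'rV[F]_d * F) : bool :=
  (\sum_(i < d) (x 0 i - s.1 0 i) ^+ 2) == s.2.

Definition is_square (F : finFieldType) (r : F) : bool := [exists t : F, r == t ^+ 2].

Definition incidences (F : finFieldType) (d : nat)
  (P : {set 'rV[F]_d}) (S : {set 'rV[F]_d * F}) : nat :=
  #|[set ps in setX P S | on_sphere ps.1 ps.2]|.

(* Main.v *)
(* A sphere of centre c and radius t^2 is a point (c, t) of F_q^(d+1), and x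
   lies on it iff (x, 0) - (c, t) is on the cone of the form
   Q(v) = v_1^2 + ... + v_d^2 - v_(d+1)^2.  When q = d = 3 (mod 4), Q is
   elliptic, and evaluating Gauss sums gives, for all w,
     q 1_(Q(w) = 0) = 1 + q^((d+1)/2) 1_(w = 0)
                      - q^(1 - (d+1)/2) sum_(Q(m) = 0) chi(w . m).
   The last term is negative semidefinite as a kernel in w = u - v, so the
   quadratic form sum_(u,v) f(u) f(v) 1_(Q(u-v) = 0) is at most
   q^(-1) (sum f)^2 + q^((d-1)/2) sum f^2.  This is only an upper bound: the
   negative eigenvalues are q - 1 times larger, so the bilinear form of
   points against spheres is not estimated directly; instead it is dominated
   by the quadratic form at f = 1_points + 1_spheres. *)
Require Import Defs.
From HB Require Import structures.
From mathcomp Require Import all_boot all_order all_algebra all_field.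
From mathcomp Require Import fingroup finalg character classfun.
From mathcomp Require Import ring zify.
Set Implicit Arguments. Unset Strict Implicit. Unset Printing Implicit Defensive.
Import Order.TTheory GRing.Theory Num.Theory.
Local Open Scope ring_scope.

(** * Characters of the additive group *)

Lemma exists_additive_character (F : finFieldType) :
  exists chi : F -> algC,
    [/\ chi 0 = 1, forall x y, chi (x + y) = chi x * chi y,
        forall x, chi (- x) = (chi x)^*
      & exists b, chi b != 1].
Proof.
pose G := [set: F]%G.
have abG : abelian G by exact: FinRing.zmod_abelian.
have lin (i : Iirr G) : 'chi_i \is a linear_char by move/char_abelianP: abG.
(* The additive group is abelian, so it has |F| > 1 irreducible characters, all linear; index 0 is
   the trivial one, and any other will do. *)
have [i i_neq0] : exists i : Iirr G, i != 0.
  have : (1 < #|Iirr G|)%N.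
    by rewrite card_Iirr_abelian // cardsT card_finNzRing_gt1.
  case/card_gt1P=> i [j] [_ _ ij].
  by case: (eqVneq i 0) ij => [->|]; [exists j; rewrite eq_sym | exists i].
exists 'chi_i; split.
- by rewrite -(lin_char1 (lin i)).
- by move=> x y; rewrite -(lin_charM (lin i)) ?inE.
- by move=> x; rewrite -(lin_charV_conj (lin i)) ?inE.
apply/existsP; apply: contraNT i_neq0 => /existsPn chi1.
rewrite -irr_eq1; apply/eqP/cfun_inP => x Gx.
by rewrite cfun1E Gx; apply/eqP; rewrite -[_ == _]negbK chi1.
Qed.

(** * Squares in a field with q = 3 (mod 4) *)

Section ThreeModFour.
Variable F : finFieldType.
Hypothesis q_mod4 : (#|F| %% 4 = 3)%N.

Lemma half_card_double : #|F| = (#|F|.-1./2).*2.+1.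
Proof. lia. Qed.

Lemma expf_half_card (x : F) : x != 0 ->
  x ^+ (#|F|.-1./2) = 1 \/ x ^+ (#|F|.-1./2) = -1.
Proof.
move=> x0; have := expf_card x; rewrite {1}half_card_double exprS -muln2 exprM.
move=> /(canRL (mulKf x0)); rewrite mulVf // => /eqP.
by rewrite sqrf_eq1 => /orP[]/eqP; [left|right].
Qed.

(* The map is [x |-> x ^+ 2 * eta x], with [eta] the quadratic character. *)
Lemma expf_half_card_add2_inj :
  injective (fun x : F => x ^+ (#|F|.-1./2 + 2)).
Proof.
set e := (_ ./2).
move=> x y /=; have [->|y0] := eqVneq y 0.
  by rewrite expr0n addn2 /= => /eqP; rewrite expf_eq0 /= => /eqP.
move=> exy; have [x0|x0] := eqVneq x 0.
  by move/esym/eqP: exy; rewrite x0 expr0n addn2 /= expf_eq0 /= => /eqP.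
(* The quotient z = x / y satisfies z^(e+2) = z^(2e) = 1. As q = 3 (mod 4), e is odd, so e + 2 and
   2e are coprime and z = 1. *)
have z1 : (x / y) ^+ (e + 2) = 1 by rewrite expr_div_n exy divff ?expf_neq0.
have z2 : (x / y) ^+ (e * 2) = 1.
  have zn0 : x / y != 0 by rewrite mulf_neq0 ?invr_neq0.
  by rewrite exprM; case: (expf_half_card zn0) => ->; rewrite ?sqrrN expr1n.
have [|m mz mdv] := prim_order_exists _ z2; first by rewrite /e; lia.
have mdv2 : (m %| e + 2)%N by rewrite (prim_order_dvd mz) z1.
have : (m %| 1)%N.
  have /eqP <- : coprime (e + 2) (e * 2).
    have eo : odd e by rewrite /e; lia.
    rewrite coprimeMr coprimen2 oddD eo andbT coprime_sym.
    by rewrite /coprime gcdnDl -/(coprime e 2) coprimen2.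
  by rewrite dvdn_gcd mdv2.
rewrite dvdn1 => /eqP m1; move: mz; rewrite m1 => /prim_expr_order.
by rewrite expr1 => /divr1_eq.
Qed.

(** With e = (q-1)/2, the permutation x -> x^(e+2) takes the value x^2 or -x^2 at each x. Reindexing
    the right side along it gives the left side, up to swapping the two summands at some x. *)
Lemma sum_sqr_sum_sqrN (R : nmodType) (f : F -> R) :
  \sum_x f (x ^+ 2) + \sum_x f (- x ^+ 2) = \sum_x f x + \sum_x f (- x).
Proof.
rewrite [in RHS](reindex_inj expf_half_card_add2_inj).
rewrite [in X in _ = _ + X](reindex_inj expf_half_card_add2_inj).
rewrite -!big_split; apply: eq_bigr => x _ /=.
have [->|x0] := eqVneq x 0; first by rewrite !expr0n addn2.
rewrite exprD; case: (expf_half_card x0) => ->; rewrite ?mul1r //.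
by rewrite mulN1r opprK addrC.
Qed.

(** Translating the sum of all elements of F by 1 shows that q = 0 in F; since q is odd, 2 = 0 would
    give 1 = 0. *)
Lemma two_neq0 : 2 != 0 :> F.
Proof.
have q0 : #|F|%:R = 0 :> F.
  apply: (addrI (\sum_(x : F) x)); rewrite addr0.
  rewrite [RHS](reindex_inj (addIr 1)) big_split /=.
  by rewrite sumr_const cardT -cardE.
apply/eqP => two0; move/eqP: q0; rewrite half_card_double -mul2n -addn1.
by rewrite natrD natrM two0 mul0r add0r oner_eq0.
Qed.

Lemma four_neq0 : 4 != 0 :> F.
Proof. by rewrite (natrM F 2 2) mulf_neq0 ?two_neq0. Qed.

End ThreeModFour.

(** * Orthogonality and Gauss sums *)

Section AdditiveCharacter.
Variables (F : finFieldType) (chi : F -> algC).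
Hypothesis chi0 : chi 0 = 1.
Hypothesis chiD : forall x y, chi (x + y) = chi x * chi y.
Hypothesis chi_nontriv : exists b, chi b != 1.
Local Notation q := (#|F|%:R : algC).

Lemma sum_chi (a : F) : \sum_x chi (a * x) = if a == 0 then q else 0.
Proof.
have [->|a0] := eqVneq a 0.
  under eq_bigr do rewrite mul0r chi0.
  by rewrite sumr_const cardT -cardE.
have [b b1] := chi_nontriv; apply/eqP; move: b1; apply: contraNT => s0.
apply/eqP/(mulIf s0); rewrite mul1r big_distrr /=.
rewrite [RHS](reindex_inj (addrI (b / a))); apply: eq_bigr => x _ /=.
by rewrite mulrDr chiD mulrCA divff // mulr1.
Qed.

Definition gauss (s : F) := \sum_x chi (s * x ^+ 2).

Hypothesis q_mod4 : (#|F| %% 4 = 3)%N.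

(** By [sum_sqr_sum_sqrN], [gauss s + gauss (- s)] is a sum of two complete character sums, both
    zero. *)
Lemma gaussN (s : F) : s != 0 -> gauss (- s) = - gauss s.
Proof.
move=> s0; apply/eqP; rewrite -addr_eq0 addrC /gauss.
under [X in _ + X]eq_bigr do rewrite mulNr -mulrN.
rewrite (sum_sqr_sum_sqrN q_mod4 (fun x => chi (s * x))).
rewrite sum_chi (negbTE s0) add0r.
under eq_bigr do rewrite mulrN -mulNr.
by rewrite sum_chi oppr_eq0 (negbTE s0).
Qed.

Lemma gauss_mulN (s : F) : s != 0 -> gauss s * gauss (- s) = q.
Proof.
move=> s0; rewrite /gauss big_distrlr /= exchange_big /=.
(* Substituting x = y + h makes s x^2 - s y^2 linear in y, so summing over y first kills every h
   except 0. *)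
transitivity (\sum_y \sum_h chi (s * h ^+ 2) * chi (2 * s * h * y)).
  apply: eq_bigr => y _; rewrite (reindex_inj (addIr y)) /=.
  by apply: eq_bigr => h _; rewrite -!chiD; congr chi; ring.
rewrite exchange_big /= (bigD1 0) //= [X in _ + X]big1 => [|h h0].
  rewrite addr0 -big_distrr /= expr0n mulr0 chi0 mul1r.
  by rewrite sum_chi mulr0 eqxx.
rewrite -big_distrr /= sum_chi ifN ?mulr0 //.
by rewrite !mulf_neq0 // two_neq0.
Qed.

Lemma sum_chi_quadratic (s m : F) : s != 0 ->
  \sum_x chi (s * x ^+ 2 + m * x) = chi (- m ^+ 2 / (4 * s)) * gauss s.
Proof.
move=> s0; have t0 := two_neq0 q_mod4.
rewrite (reindex_inj (addIr (- m / (2 * s)))) /gauss big_distrr /=.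
apply: eq_bigr => x _; rewrite -chiD; congr chi.
have f0 := four_neq0 q_mod4.
by field; rewrite s0 f0 t0.
Qed.

(** * Fourier transform of the light cone *)

Definition lorentz d (v : 'rV[F]_d * F) := \sum_i v.1 0 i ^+ 2 - v.2 ^+ 2.
Definition dot d (m v : 'rV[F]_d * F) := \sum_i m.1 0 i * v.1 0 i + m.2 * v.2.

Lemma sum_rV_prod d (f : 'I_d -> F -> algC) :
  \sum_(x : 'rV[F]_d) \prod_i f i (x 0 i) = \prod_i \sum_y f i y.
Proof.
rewrite bigA_distr_bigA /= (reindex (fun g : {ffun 'I_d -> F} => \row_i g i)) /=.
  by apply: eq_bigr => g _; apply: eq_bigr => i _; rewrite mxE.
exists (fun x : 'rV[F]_d => [ffun i => x 0 i]) => [g _|x _].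
  by apply/ffunP => i; rewrite ffunE mxE.
by apply/rowP => i; rewrite mxE ffunE.
Qed.

Lemma chi_sum (I : finType) (f : I -> F) : chi (\sum_i f i) = \prod_i chi (f i).
Proof. exact: (big_morph chi chiD chi0). Qed.

Variable k : nat.
Let d := (4 * k + 3)%N.

Lemma sum_chi_lorentz s (m : 'rV[F]_d * F) : s != 0 ->
  \sum_v chi (s * lorentz v + dot m v)
    = - q ^+ (2 * k + 2) * chi (- lorentz m / (4 * s)).
Proof.
move=> s0.
transitivity (\sum_(x : 'rV[F]_d) \sum_t
    (\prod_i chi (s * x 0 i ^+ 2 + m.1 0 i * x 0 i))
    * chi (- s * t ^+ 2 + m.2 * t)).
  rewrite pair_big /=; apply: eq_bigr => v _.
  rewrite -chi_sum -chiD; congr chi.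
  by rewrite /lorentz /dot big_split /= -big_distrr /=; ring.
under eq_bigr do rewrite -big_distrr /=.
rewrite -big_distrl /=.
rewrite (sum_rV_prod (fun i y => chi (s * y ^+ 2 + m.1 0 i * y))).
rewrite sum_chi_quadratic ?oppr_eq0 //.
under eq_bigr do rewrite sum_chi_quadratic //.
rewrite big_split /= prodr_const card_ord -chi_sum.
(* One of the d factors [gauss s] pairs with [gauss (- s)] to give q; the other 4k+2 give
   (-q)^(2k+1). The minus sign, the same for all s, comes from 2k+1 being odd, that is, from d = 3
   (mod 4). *)
have gE : gauss s ^+ d * gauss (- s) = - q ^+ (2 * k + 2).
  rewrite (_ : d = (2 * (2 * k + 1)).+1); last by rewrite /d; lia.
  rewrite exprSr -mulrA gauss_mulN // exprM.
  have -> : gauss s ^+ 2 = - q.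
    by rewrite expr2 -(gauss_mulN s0) gaussN // mulrN opprK.
  rewrite exprNn addn1 exprS exprM sqrrN !expr1n mulr1 mulN1r mulNr -exprSr.
  by rewrite addn2.
rewrite mulrACA -chiD gE mulrC; congr (_ * chi _).
rewrite /lorentz opprB -mulr_suml sumrN.
have f0 := four_neq0 q_mod4.
by field; rewrite oppr_eq0 s0 f0.
Qed.

Lemma sum_chi_dot (w : 'rV[F]_d * F) :
  \sum_m chi (dot w m) = if w == 0 then q ^+ (4 * k + 4) else 0.
Proof.
transitivity (\sum_(x : 'rV[F]_d) \sum_t
    (\prod_i chi (w.1 0 i * x 0 i)) * chi (w.2 * t)).
  by rewrite pair_big /=; apply: eq_bigr => v _; rewrite -chi_sum -chiD.
under eq_bigr do rewrite -big_distrr /=.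
rewrite -big_distrl /= (sum_rV_prod (fun i y => chi (w.1 0 i * y))) sum_chi.
under eq_bigr do rewrite sum_chi.
have [->|/eqP w_neq0] := eqVneq w 0.
  under eq_bigr do rewrite mxE eqxx.
  by rewrite eqxx prodr_const card_ord -exprSr /d -addnS.
have [w2|] := eqVneq w.2 0; last by rewrite mulr0.
have [i wi] : exists i, w.1 0 i != 0.
  apply/existsP; apply: contra_notT w_neq0 => /existsPn w1.
  rewrite [w]surjective_pairing w2; congr pair.
  by apply/rowP => i; rewrite mxE; apply/eqP; rewrite -[_ == _]negbK w1.
by rewrite (bigD1 i) //= (negbTE wi) !mul0r.
Qed.

Lemma sum_chi_neq0 (a : F) :
  \sum_(s | s != 0) chi (s * a) = (if a == 0 then q else 0) - 1.
Proof.
rewrite -sum_chi [in RHS](bigD1 0) //= mulr0 chi0 addrC addrK.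
by apply: eq_bigr => s _; rewrite mulrC.
Qed.

(** Q(w) = 0 is detected by summing chi(a Q(w)) over nonzero a. Writing a = -1/(4s) turns each term
    into a Gaussian sum over m by [sum_chi_lorentz]; summing over s first then detects Q(m) = 0. *)
Lemma sum_chi_light_cone (w : 'rV[F]_d * F) :
  q ^+ (2 * k + 2) * ((if lorentz w == 0 then q else 0) - 1)
    = (if w == 0 then q ^+ (4 * k + 4) else 0)
      - q * \sum_(m : 'rV[F]_d * F | lorentz m == 0) chi (dot w m).
Proof.
have f0 := four_neq0 q_mod4.
have N4_inj : injective (fun s : F => (- (4 * s))^-1).
  by move=> x y /invr_inj/oppr_inj/(mulfI f0).
rewrite -sum_chi_neq0 (reindex_inj N4_inj) /= big_distrr /=.
transitivity (\sum_(s : F | s != 0) \sum_m - chi (s * lorentz m + dot w m)).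
  apply: eq_big => [s|s]; first by rewrite invr_eq0 oppr_eq0 mulf_eq0 negb_or f0.
  rewrite invr_eq0 oppr_eq0 mulf_eq0 negb_or f0 /= => s0.
  rewrite sumrN sum_chi_lorentz // mulNr opprK; congr (_ * chi _).
  by rewrite invrN mulNr mulNr mulrC.
rewrite exchange_big /= -sum_chi_dot big_distrr /= [X in _ - X]big_mkcond /=.
rewrite -sumrB; apply: eq_bigr => m _.
rewrite sumrN; under eq_bigr do rewrite chiD.
rewrite -big_distrl /= sum_chi_neq0; case: ifP => _; ring.
Qed.

(** * Upper bound for the quadratic form of the cone *)

Hypothesis chiN : forall x, chi (- x) = (chi x)^*.

Lemma dotBl (u v m : 'rV[F]_d * F) : dot (u - v) m = dot u m - dot v m.
Proof.
rewrite /dot /= mulrBl opprD addrACA -sumrB; congr (_ + _).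
by apply: eq_bigr => i _; rewrite !mxE mulrBl.
Qed.

Lemma light_cone_form_le (f : 'rV[F]_d * F -> algC) :
  (forall v, f v \is Num.real) ->
  \sum_u \sum_v f u * f v * (lorentz (u - v) == 0)%:R
    <= (\sum_v f v) ^+ 2 / q + q ^+ (2 * k + 1) * \sum_v f v ^+ 2.
Proof.
move=> f_real; have q_gt0 : 0 < q.
  by rewrite ltr0n; apply/card_gt0P; exists 0.
(* This factor clears denominators: q^(2k+2) scales [sum_chi_light_cone], and one more q multiplies
   the indicator there. *)
rewrite -(ler_pM2l (exprn_gt0 (2 * k + 3) q_gt0)).
have -> : q ^+ (2 * k + 3)
    * \sum_u \sum_v f u * f v * (lorentz (u - v) == 0)%:R
  = q ^+ (2 * k + 2) * (\sum_v f v) ^+ 2 + q ^+ (4 * k + 4) * \sum_v f v ^+ 2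
    - q * \sum_(m : 'rV[F]_d * F | lorentz m == 0)
        `|\sum_u f u * chi (dot u m)| ^+ 2.
  transitivity (\sum_u \sum_v f u * f v * (q ^+ (2 * k + 2)
     + (if u - v == 0 then q ^+ (4 * k + 4) else 0)
      - q * \sum_(m : 'rV[F]_d * F | lorentz m == 0) chi (dot (u - v) m))).
    rewrite big_distrr /=; apply: eq_bigr => u _.
    rewrite big_distrr /=; apply: eq_bigr => v _.
    rewrite -addrA -sum_chi_light_cone (addnS (2 * k) 2) exprSr.
    by case: eqP => _ /=; ring.
  under eq_bigr do under eq_bigr do rewrite mulrBr mulrDr.
  under eq_bigr do rewrite sumrB big_split /=.
  rewrite sumrB big_split /=; congr (_ + _ - _).
  - rewrite expr2 big_distrlr big_distrr /=; apply: eq_bigr => u _.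
    by rewrite big_distrr /=; apply: eq_bigr => v _; rewrite mulrC.
  - rewrite big_distrr /=; apply: eq_bigr => u _.
    rewrite (bigD1 u) //= subrr eqxx big1 => [|v vu].
      by rewrite addr0 mulrC expr2.
    by rewrite subr_eq0 eq_sym (negbTE vu) mulr0.
  rewrite big_distrr /=.
  (* Expand each squared modulus as a double sum; since f is real, conjugation affects only chi, and
     the two characters combine to chi of (u - v) . m. *)
  under [RHS]eq_bigr => m _.
    rewrite normCK rmorph_sum big_distrlr big_distrr /=.
    under eq_bigr do rewrite big_distrr /=.
    over.
  rewrite [RHS]exchange_big /=; apply: eq_bigr => u _.
  rewrite [RHS]exchange_big /=; apply: eq_bigr => v _.
  rewrite mulrCA 2!big_distrr /=; apply: eq_bigr => m _.
  by rewrite dotBl chiD chiN rmorphM /= (conj_Creal (f_real v)); ring.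
have -> : q ^+ (2 * k + 3) * ((\sum_v f v) ^+ 2 / q
      + q ^+ (2 * k + 1) * \sum_v f v ^+ 2)
  = q ^+ (2 * k + 2) * (\sum_v f v) ^+ 2 + q ^+ (4 * k + 4) * \sum_v f v ^+ 2.
  rewrite (_ : 4 * k + 4 = 2 * k + 3 + (2 * k + 1))%N; last by lia.
  rewrite (exprD q (2 * k + 3)) (addnS (2 * k) 2) (exprSr q (2 * k + 2)).
  by field; rewrite gt_eqF.
rewrite gerBl mulr_ge0 ?(ltW q_gt0) // sumr_ge0 // => m _.
by rewrite exprn_ge0.
Qed.

End AdditiveCharacter.

(** * From spheres to points of the cone geometry *)

Section Incidences.
Variables (F : finFieldType) (d : nat).
Variables (P : {set 'rV[F]_d}) (S : {set 'rV[F]_d * F}).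
Hypothesis S_square : forall s, s \in S -> is_square s.2.

Lemma incidencesE :
  incidences P S = (\sum_(x in P) \sum_(s in S) on_sphere x s)%N.
Proof.
rewrite /incidences -sum1_card pair_big_dep /= -[RHS]big_mkcondr /=.
by apply: eq_bigl => -[x s]; rewrite !inE.
Qed.

Definition light_point (x : 'rV[F]_d) : 'rV[F]_d * F := (x, 0).
(** One square root of the radius is chosen per sphere; the default 0 is reached only at non-square
    radii, hence never on S. *)
Definition light_sphere (s : 'rV[F]_d * F) : 'rV[F]_d * F :=
  (s.1, odflt 0 [pick t | s.2 == t ^+ 2]).

Lemma light_sphere_radius s : s \in S -> (light_sphere s).2 ^+ 2 = s.2.
Proof.
move=> /S_square/existsP[t0 ht0]; rewrite /light_sphere /=.
by case: pickP => [t /eqP->//|/(_ t0)]; rewrite ht0.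
Qed.

Lemma light_sphere_inj : {in S &, injective light_sphere}.
Proof.
move=> s t sS tS e; rewrite [s]surjective_pairing [t]surjective_pairing.
congr pair; first exact: (congr1 fst e).
by rewrite -(light_sphere_radius sS) e light_sphere_radius.
Qed.

Lemma on_sphere_lorentz x s : s \in S ->
  on_sphere x s = (lorentz (light_point x - light_sphere s) == 0).
Proof.
move=> /light_sphere_radius r_s; rewrite /lorentz /= sub0r sqrrN r_s subr_eq0.
by rewrite /on_sphere; congr (_ == _); apply: eq_bigr => i _; rewrite !mxE.
Qed.

End Incidences.

Lemma incidences_le (F : finFieldType) (k : nat)
    (P : {set 'rV[F]_(4 * k + 3)}) (S : {set 'rV[F]_(4 * k + 3) * F}) (N : nat) :
  (#|F| %% 4 = 3)%N -> (forall s, s \in S -> is_square s.2) ->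
  (#|P| <= N)%N -> (#|S| <= N)%N ->
  (incidences P S)%:R <=
    4 * (N%:R ^+ 2 / #|F|%:R + #|F|%:R ^+ (2 * k + 1) * N%:R) :> algC.
Proof.
move=> q_mod4 S_square PN SN.
have [chi [chi0 chiD chiN chi_nontriv]] := exists_additive_character F.
pose A := [set light_point x | x in P]; pose B := [set light_sphere s | s in S].
(* A and B can meet, since a sphere of radius 0 becomes (c, 0); so f may take the value 2. *)
pose f v : algC := (v \in A)%:R + (v \in B)%:R.
have f_ge0 v : 0 <= f v by rewrite addr_ge0 ?ler0n.
have f_le2 v : f v <= 2.
  by rewrite /f; do 2!case: (v \in _); rewrite ?addr0 ?add0r ?ler0n ?ler_nat.
have sum_f : \sum_v f v <= 2 * N%:R.
  have card_im (X : {set 'rV[F]_(4 * k + 3) * F}) :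
      \sum_v (v \in X)%:R = #|X|%:R :> algC.
    by rewrite -natr_sum -sum1_card [in RHS]big_mkcond.
  rewrite big_split /= !card_im mulr_natl mulr2n.
  by rewrite lerD // ler_nat (leq_trans (leq_imset_card _ _)).
have f_real v : f v \is Num.real by exact: ger0_real.
have := light_cone_form_le chi0 chiD chi_nontriv q_mod4 chiN f_real.
set form := (X in X <= _) => form_le.
(* The incidences are the terms with u in A and v in B, where f is at least 1 at both; all other
   terms are nonnegative. *)
have inc_le : (incidences P S)%:R <= form.
  apply: (@le_trans _ _ (\sum_(u in A) \sum_(v in B)
      (lorentz (u - v) == 0)%:R)).
    rewrite big_imset /=; last by move=> x y _ _ [].
    rewrite incidencesE natr_sum; apply: ler_sum => x xP.
    rewrite natr_sum big_imset /=; last exact: light_sphere_inj.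
    by apply: ler_sum => s sS; rewrite (on_sphere_lorentz S_square).
  rewrite /form big_mkcond; apply: ler_sum => u _.
  rewrite -[X in if _ then X else _]/(\sum_(v in B) _) big_mkcond /=.
  case: ifP => uA; last by apply: sumr_ge0 => v _; rewrite !mulr_ge0.
  apply: ler_sum => v _; case: ifP => vB; last by rewrite !mulr_ge0.
  by rewrite ler_peMl // mulr_ege1 // /f ?uA ?vB ?lerDl ?lerDr.
(* Here f^2 <= 2 f, and the sum of f is at most 2N. *)
have sum_f2 : \sum_v f v ^+ 2 <= 4 * N%:R.
  apply: (@le_trans _ _ (\sum_v 2 * f v)).
    by apply: ler_sum => v _; rewrite expr2 ler_wpM2r.
  have -> : 4 * N%:R = 2 * (2 * N%:R) :> algC by ring.
  by rewrite -big_distrr /= ler_pM2l.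
apply: (le_trans inc_le); apply: (le_trans form_le); rewrite mulrDr lerD //.
  rewrite mulrA ler_wpM2r ?invr_ge0 //.
  have -> : 4 * N%:R ^+ 2 = (2 * N%:R) ^+ 2 :> algC by ring.
  by rewrite ler_pXn2r // nnegrE ?mulr_ge0 ?sumr_ge0.
by rewrite mulrCA ler_wpM2l // exprn_ge0.
Qed.

Theorem theorem1p4 :
  exists C : rat, 0 < C /\
  forall (F : finFieldType) (d : nat) (P : {set 'rV[F]_d}) (S : {set 'rV[F]_d * F}) (N : nat),
    odd #|F| -> (#|F| %% 4 = 3)%N ->
    (0 < d)%N -> (d %% 4 = 3)%N ->
    (forall s, s \in S -> is_square s.2) ->
    (#|P| <= N)%N -> (#|S| <= N)%N ->
    (incidences P S)%:R <=
      C * ((N%:R ^+ 2) / (#|F|%:R) + (#|F|%:R ^+ ((d - 1) %/ 2)) * N%:R).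
Proof.
(* The constant 4 serves both terms: (2N)^2 for the squared sum of f, and 4N for the sum of f^2. *)
exists 4; split=> // F d P S N _ q_mod4 _ d_mod4 S_square PN SN.
have dE : d = (4 * (d %/ 4) + 3)%N by lia.
move: (d %/ 4)%N dE => k dE; subst d.
have -> : ((4 * k + 3 - 1) %/ 2 = 2 * k + 1)%N by lia.
(* The inequality moves from [rat] to [algC], where the characters take their values. *)
rewrite -(ler_rat algC) ratr_nat !(rmorph_nat, rmorphXn, fmorphV, rmorphM, rmorphD).
exact: incidences_le.
Qed.
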